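(* For any planar, non-collinear four-body central configuration, the reduced transverse Laplacian matrix $\ell$ has rank $1$.
   Context: Four bodies have masses $m_1,\dots,m_4>0$, $M=\sum_i m_i$, pairwise distinct positions $\mathbf r_i\in\mathbb R^2$ with $\sum_i m_i\mathbf r_i=0$; $\mathbf q_{ij}=\mathbf r_i-\mathbf r_j$, $q_{ij}=|\mathbf q_{ij}|$, $\mu_{ij}=m_im_j/M$. The configuration is central if there is $\omega^2>0$ with $\omega^2m_i\mathbf r_i=\sum_{j\ne i}\frac{m_im_j}{q_{ij}^3}\mathbf q_{ij}$ for all $i$ (such $\omega^2$ is then uniquely determined). It is non-collinear if the four positions do not lie on one line. Put $\alpha_{ij}^\perp=\alpha_{ji}^\perp=\mu_{ij}(\omega^2-M/q_{ij}^3)$. The reduced transverse Laplacian $\ell\in\mathbb R^{3\times3}$ has entries indexed by bodies $a,b\in\{2,3,4\}$: $\ell_{a-1,a-1}=\sum_{k\ne a}\alpha_{ak}^\perp$ (sum over $k\in\{1,2,3,4\}$, $k\neq a$) and $\ell_{a-1,b-1}=-\alpha_{ab}^\perp$ for $a\neq b$. *)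

(* Defs.v *)
From mathcomp Require Import all_boot all_order all_algebra.
From mathcomp Require Import reals.
Set Implicit Arguments.
Unset Strict Implicit.
Unset Printing Implicit Defensive.

Import Order.TTheory GRing.Theory Num.Theory.
Local Open Scope ring_scope.

(* The bodies 1, 2, 3, 4 are the elements 0, 1, 2, 3 of 'I_4. *)

Section FourBody.
Variables (R : realType) (m : 'I_4 -> R) (r : 'I_4 -> 'rV[R]_2).

(* The norm that MathComp-Analysis puts on 'rV[R]_2 is the sup norm. *)
Definition enorm (v : 'rV[R]_2) : R := Num.sqrt (\sum_k v 0 k ^+ 2).

Definition total_mass : R := \sum_i m i.

Definition dist (i j : 'I_4) : R := enorm (r i - r j).

Definition reduced_mass (i j : 'I_4) : R := m i * m j / total_mass.

Definition collinear : Prop :=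
  exists (p v : 'rV[R]_2), v != 0 /\ forall i, exists t : R, r i = p + t *: v.

(* [omega2] stands for the square of the angular velocity omega. *)
Definition central_with (omega2 : R) : Prop :=
  0 < omega2 /\
  forall i, (omega2 * m i) *: r i =
    \sum_(j | j != i) (m i * m j / dist i j ^+ 3) *: (r i - r j).

Definition alpha_perp (omega2 : R) (i j : 'I_4) : R :=
  reduced_mass i j * (omega2 - total_mass / dist i j ^+ 3).

(* [lift ord0 : 'I_3 -> 'I_4] sends 0, 1, 2 to 1, 2, 3, that is, to the bodies
   2, 3, 4. *)
Definition ell (omega2 : R) : 'M[R]_3 :=
  \matrix_(i, j)
    (let a := lift ord0 i in
     let b := lift ord0 j in
     if a == b then \sum_(k | k != a) alpha_perp omega2 a k
     else - alpha_perp omega2 a b).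

End FourBody.

(* Main.v *)
(** The relative positions [r a - r 1], [a = 2, 3, 4], are the rows of a
    [3 x 2] matrix of rank 2, because the configuration is not collinear. By the
    equations of a central configuration, [ell] annihilates this matrix, so
    [ell] has rank at most 1. If [ell] were zero, all the [alpha_perp] would
    vanish, and the four bodies would be pairwise equidistant; this is impossible
    in the plane, where the Gram determinant of three vectors vanishes. *)
Require Import Defs.
From mathcomp Require Import all_boot all_order all_algebra.
From mathcomp Require Import reals.
From mathcomp Require Import ring lra.
Set Implicit Arguments.
Unset Strict Implicit.
Unset Printing Implicit Defensive.
Import Order.TTheory GRing.Theory Num.Theory.
Local Open Scope ring_scope.

Definition relative_positions (R : realType) (r : 'I_4 -> 'rV[R]_2) :
    'M[R]_(3, 2) :=
  \matrix_i (r (lift ord0 i) - r ord0).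

Lemma ord2P (k : 'I_2) : k = 0 \/ k = 1.
Proof. by case: k => -[|[|]] // ?; [left|right]; apply: val_inj. Qed.

(** By contraposition: if the rank is not 2, some nonzero [u] is orthogonal to every relative
    position, so all bodies lie on the line through body 1 perpendicular to [u]. *)
Lemma relative_positions_rank (R : realType) (r : 'I_4 -> 'rV[R]_2) :
  ~ collinear r -> \rank (relative_positions r) = 2%N.
Proof.
move=> ncol; apply/eqP; apply: contra_notT ncol => rk.
have : kermx (relative_positions r)^T != 0.
  by rewrite kermx_eq0 /row_free mxrank_tr.
case/rowV0Pn => u /sub_kermxP uD0 u0.
(* [v] is [u] turned by a right angle, the direction of that line. *)
pose v : 'rV[R]_2 := \row_k (if k == 0 then - u 0 1 else u 0 0).
have v0 k : v 0 k = if k == 0 then - u 0 1 else u 0 0 by rewrite mxE.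
have n0 : u 0 0 ^+ 2 + u 0 1 ^+ 2 != 0.
  apply: contraNneq u0 => /eqP; rewrite paddr_eq0 ?sqr_ge0 // !sqrf_eq0.
  case/andP => /eqP u00 /eqP u01; apply/eqP/rowP => k.
  by rewrite mxE; case: (ord2P k) => ->.
exists (r ord0), v; split.
  apply: contraNneq u0 => e; apply/eqP/rowP => k.
  have := v0 0; have := v0 1; rewrite e !mxE /= => e0 e1.
  by case: (ord2P k) => ->; rewrite -?e0 //; apply/eqP; rewrite -oppr_eq0 -e1.
move=> i; case: (unliftP ord0 i) => [j ->|->]; last first.
  by exists 0; rewrite scale0r addr0.
pose w := r (lift ord0 j) - r ord0.
have orth : u 0 0 * w 0 0 + u 0 1 * w 0 1 = 0.
  have /rowP/(_ j) := uD0; rewrite !mxE big_ord_recl big_ord1 !mxE.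
  by have -> : lift ord0 (ord0 : 'I_1) = 1 :> 'I_2 by apply: val_inj.
(* The coefficient of the projection of [w] on [v]. *)
exists ((u 0 0 * w 0 1 - u 0 1 * w 0 0) / (u 0 0 ^+ 2 + u 0 1 ^+ 2)).
apply/eqP; rewrite addrC -subr_eq -/w; apply/eqP/rowP => k.
rewrite [RHS]mxE v0; case: (ord2P k) => -> /=; apply: (mulIf n0).
  rewrite mulrAC divfK //; apply/eqP; rewrite -subr_eq0; apply/eqP.
  by transitivity (u 0 0 * (u 0 0 * w 0 0 + u 0 1 * w 0 1)); [ring | rewrite orth mulr0].
rewrite mulrAC divfK //; apply/eqP; rewrite -subr_eq0; apply/eqP.
by transitivity (u 0 1 * (u 0 0 * w 0 0 + u 0 1 * w 0 1)); [ring | rewrite orth mulr0].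
Qed.

Lemma total_mass_gt0 (R : realType) (m : 'I_4 -> R) :
  (forall i, 0 < m i) -> 0 < total_mass m.
Proof.
move=> m_gt0; rewrite /total_mass big_ord_recl ltr_wpDr //.
by apply: sumr_ge0 => j _; apply: ltW.
Qed.

(** The [omega2] part sums to [omega2 * m i *: r i] because the barycenter is the origin; in the
    other part the total mass cancels, which leaves the attraction term of the central equation. *)
Lemma alpha_perp_balance (R : realType) (m : 'I_4 -> R)
    (r : 'I_4 -> 'rV[R]_2) (omega2 : R) (i : 'I_4) :
  (forall i, 0 < m i) -> \sum_i m i *: r i = 0 -> central_with m r omega2 ->
  \sum_(j | j != i) alpha_perp m r omega2 i j *: (r i - r j) = 0.
Proof.
move=> m_gt0 bary [_ /(_ i) cent].
have M0 : total_mass m != 0 by rewrite gt_eqF ?total_mass_gt0.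
have lin : \sum_(j | j != i) (m i * m j / total_mass m * omega2) *: (r i - r j)
         = (omega2 * m i) *: r i.
  transitivity (\sum_j (m i * m j / total_mass m * omega2) *: (r i - r j)).
    by rewrite [RHS](bigD1 i) //= subrr scaler0 add0r.
  transitivity ((m i / total_mass m * omega2) *: \sum_j (m j *: r i - m j *: r j)).
    rewrite scaler_sumr; apply: eq_bigr => j _.
    by rewrite -scalerBr scalerA; congr (_ *: _); ring.
  rewrite sumrB bary subr0 -scaler_suml scalerA -/(total_mass m).
  by congr (_ *: _); field.
transitivity (\sum_(j | j != i) ((m i * m j / total_mass m * omega2) *: (r i - r j)
    - (m i * m j / dist r i j ^+ 3) *: (r i - r j))).
  apply: eq_bigr => j _; rewrite -scalerBl; congr (_ *: _).
  rewrite /alpha_perp /reduced_mass mulrBr; congr (_ - _).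
  by rewrite mulrA divfK.
by rewrite sumrB lin -cent subrr.
Qed.

Lemma ell_relative_positions (R : realType) (m : 'I_4 -> R)
    (r : 'I_4 -> 'rV[R]_2) (omega2 : R) :
  (forall i, 0 < m i) -> \sum_i m i *: r i = 0 -> central_with m r omega2 ->
  ell m r omega2 *m relative_positions r = 0.
Proof.
move=> m_gt0 bary cent; apply/row_matrixP => i; rewrite row0 row_mul mulmx_sum_row.
set a := lift ord0 i.
(* Row [a] of the full 4 x 4 Laplacian. Its entry at [ord0] does no harm, being multiplied by
   [r ord0 - r ord0]. *)
pose L b := if a == b then \sum_(k | k != a) alpha_perp m r omega2 a k
            else - alpha_perp m r omega2 a b.
transitivity (\sum_b L b *: (r b - r ord0)).
  rewrite [RHS]big_ord_recl subrr scaler0 add0r; apply: eq_bigr => j _.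
  by rewrite rowK !mxE.
rewrite (bigD1 a) //= {1}/L eqxx scaler_suml -big_split /=.
rewrite -[RHS](alpha_perp_balance a m_gt0 bary cent); apply: eq_bigr => b ba.
rewrite /L eq_sym (negPf ba) scaleNr -scalerBr; congr (_ *: _).
by rewrite opprB addrA subrK.
Qed.

(** Off-diagonal entries settle the pairs among bodies 2, 3, 4; each diagonal entry then reduces to
    the pair with body 1. *)
Lemma alpha_perp_ell0 (R : realType) (m : 'I_4 -> R) (r : 'I_4 -> 'rV[R]_2)
    (omega2 : R) :
  ell m r omega2 = 0 ->
  forall (i : 'I_3) b, b != lift ord0 i -> alpha_perp m r omega2 (lift ord0 i) b = 0.
Proof.
move=> e0 i.
have off j : j != i -> alpha_perp m r omega2 (lift ord0 i) (lift ord0 j) = 0.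
  move=> ji; have /matrixP/(_ i j) := e0; rewrite !mxE /=.
  by rewrite (inj_eq lift_inj) eq_sym (negPf ji) => /eqP; rewrite oppr_eq0 => /eqP.
move=> b; case: (unliftP ord0 b) => [j ->|-> _].
  by rewrite (inj_eq lift_inj); apply: off.
have /matrixP/(_ i i) := e0; rewrite !mxE /= eqxx (bigD1 ord0) //= big1 ?addr0 //.
move=> k /andP[]; case: (unliftP ord0 k) => [j ->|->]; last by rewrite eqxx.
by rewrite (inj_eq lift_inj) => + _; apply: off.
Qed.

Lemma dist_sqr (R : realType) (r : 'I_4 -> 'rV[R]_2) i j :
  dist r i j ^+ 2 = (r i 0 0 - r j 0 0) ^+ 2 + (r i 0 1 - r j 0 1) ^+ 2.
Proof.
rewrite /dist /enorm sqr_sqrtr ?sumr_ge0 // => [|k _]; last exact: sqr_ge0.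
rewrite big_ord_recl big_ord1 !mxE.
by have -> : lift ord0 (ord0 : 'I_1) = 1 :> 'I_2 by apply: val_inj.
Qed.

Lemma dist_alpha_perp0 (R : realType) (m : 'I_4 -> R) (r : 'I_4 -> 'rV[R]_2)
    (omega2 : R) i j :
  (forall i, 0 < m i) -> r i != r j -> alpha_perp m r omega2 i j = 0 ->
  omega2 * dist r i j ^+ 3 = total_mass m.
Proof.
move=> m_gt0 rij.
have d0 : dist r i j != 0.
  apply: contraNneq rij => d0; have := dist_sqr r i j.
  rewrite d0 expr0n => /esym/eqP; rewrite paddr_eq0 ?sqr_ge0 // !sqrf_eq0 !subr_eq0.
  case/andP => /eqP e0 /eqP e1; apply/eqP/rowP => k.
  by case: (ord2P k) => ->.
have mu0 : reduced_mass m i j != 0.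
  by rewrite gt_eqF // divr_gt0 ?mulr_gt0 ?total_mass_gt0.
move=> /eqP; rewrite mulf_eq0 (negPf mu0) subr_eq0 => /eqP ->.
by rewrite divfK // expf_neq0.
Qed.

(* The Gram matrix of three vectors of length [sqrt s] at mutual distance
   [sqrt s] has diagonal entries [s] and off-diagonal entries [s / 2], so its
   determinant is [s ^+ 3 / 2]. *)
Lemma plane_equilateral (R : realType) (x1 y1 x2 y2 x3 y3 s : R) :
  x1 ^+ 2 + y1 ^+ 2 = s -> x2 ^+ 2 + y2 ^+ 2 = s -> x3 ^+ 2 + y3 ^+ 2 = s ->
  (x1 - x2) ^+ 2 + (y1 - y2) ^+ 2 = s -> (x1 - x3) ^+ 2 + (y1 - y3) ^+ 2 = s ->
  (x2 - x3) ^+ 2 + (y2 - y3) ^+ 2 = s -> s = 0.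
Proof.
move=> s1 s2 s3 s12 s13 s23.
(* Law of cosines: expanding the squared distance gives [s + s - 2 * (x1 * x2 + y1 * y2) = s]. *)
have g12 : x1 * x2 + y1 * y2 = s / 2 by lra.
have g13 : x1 * x3 + y1 * y3 = s / 2 by lra.
have g23 : x2 * x3 + y2 * y3 = s / 2 by lra.
(* The expanded Gram determinant, with its entries as variables so that [s] and [s / 2] can be
   substituted for them. *)
have gram (a b c d e f : R) :
    a = x1 ^+ 2 + y1 ^+ 2 -> b = x2 ^+ 2 + y2 ^+ 2 -> c = x3 ^+ 2 + y3 ^+ 2 ->
    d = x1 * x2 + y1 * y2 -> e = x1 * x3 + y1 * y3 -> f = x2 * x3 + y2 * y3 ->
    a * b * c + 2 * d * e * f - a * f ^+ 2 - b * e ^+ 2 - c * d ^+ 2 = 0.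
  by move=> -> -> -> -> -> ->; ring.
have := gram s s s (s / 2) (s / 2) (s / 2).
rewrite s1 s2 s3 g12 g13 g23 => /(_ erefl erefl erefl erefl erefl erefl) s0.
have : s ^+ 3 = 0 by lra.
by move/eqP; rewrite expf_eq0 /= => /eqP.
Qed.

Theorem proposition5p1 (R : realType) (m : 'I_4 -> R) (r : 'I_4 -> 'rV[R]_2)
    (omega2 : R)
    (m_gt0 : forall i, 0 < m i)
    (r_distinct : forall i j, i != j -> r i != r j)
    (r_barycenter : \sum_i m i *: r i = 0)
    (r_central : central_with m r omega2)
    (r_noncollinear : ~ collinear r) :
  \rank (ell m r omega2) = 1%N.
Proof.
apply/eqP; rewrite eqn_leq; apply/andP; split.
  (* As the product is zero, the two ranks add up to at most 3, the inner dimension. *)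
  have := mulmx0_rank_max (ell_relative_positions m_gt0 r_barycenter r_central).
  by rewrite relative_positions_rank // addn2.
rewrite lt0n mxrank_eq0; apply/eqP => /alpha_perp_ell0 alpha0.
have [w_gt0 _] := r_central.
pose c : 'I_3 -> 'I_4 := lift ord0.
have distE (i : 'I_3) b : b != c i -> omega2 * dist r (c i) b ^+ 3 = total_mass m.
  move=> bi; apply: dist_alpha_perp0 => //; last exact: alpha0.
  by apply: r_distinct; rewrite eq_sym.
pose s := dist r (c 0) ord0 ^+ 2.
have sE (i : 'I_3) b : b != c i -> dist r (c i) b ^+ 2 = s.
  (* Cubing is injective on nonnegative reals, so equal cubes of distances give equal distances. *)
  move=> bi; congr (_ ^+ 2); apply: (@pexpIrn _ 3) => //; rewrite ?nnegrE ?sqrtr_ge0 //.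
  by apply: (mulfI (lt0r_neq0 w_gt0)); rewrite !distE.
have /eqP s0 : s = 0.
  pose X i k := r (c i) 0 k - r ord0 0 k.
  have X0 i : X i 0 ^+ 2 + X i 1 ^+ 2 = s by rewrite -dist_sqr sE.
  have X1 i j : j != i -> (X i 0 - X j 0) ^+ 2 + (X i 1 - X j 1) ^+ 2 = s.
    move=> ji; rewrite -(sE i (c j)) ?(inj_eq lift_inj) // dist_sqr.
    by rewrite /X; ring.
  by apply: (plane_equilateral (X0 0) (X0 1) (X0 2)); apply: X1.
move: s0; rewrite /s sqrf_eq0 => /eqP d0.
(* A zero distance would make the total mass zero. *)
have := distE 0 ord0 isT; rewrite d0 expr0n /= mulr0 => /eqP.
by rewrite lt_eqF // total_mass_gt0.
Qed.
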